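(* Let $K$ be a field and let $G$ be a group. The partial group algebra $K_{\mathrm{par}}[G]$ is artinian if and only if $G$ is a finite group.
   Context: A ring is artinian if it is both left and right artinian. The partial group algebra $K_{\mathrm{par}}[G]$ is the universal associative unital $K$-algebra generated by the symbols $\{[g] : g\in G\}$ subject to the relations, for all $s,t\in G$: $[e]=1$ (where $e$ is the identity of $G$), $[s^{-1}][s][t]=[s^{-1}][st]$ and $[s][t][t^{-1}]=[st][t^{-1}]$. *)

(* Defs.v *)
From HB Require Import structures.
From mathcomp Require Import all_boot all_order all_algebra.
From mathcomp Require Import generic_quotient.
From mathcomp Require Import boolp classical_sets cardinality.

Set Implicit Arguments.
Unset Strict Implicit.
Unset Printing Implicit Defensive.

Import GRing.Theory.

Local Open Scope classical_set_scope.
Local Open Scope ring_scope.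

Section Artinian.
Variable R : nzRingType.

Definition left_ideal (I : set R) : Prop :=
  [/\ I 0, forall x y, I x -> I y -> I (x - y) & forall a x, I x -> I (a * x)].

Definition right_ideal (I : set R) : Prop :=
  [/\ I 0, forall x y, I x -> I y -> I (x - y) & forall a x, I x -> I (x * a)].

Definition dcc (P : set (set R)) : Prop :=
  forall I : nat -> set R, (forall n, P (I n)) ->
    (forall n, I n.+1 `<=` I n) ->
    exists N, forall n, (N <= n)%N -> I n = I N.

Definition artinian : Prop := dcc left_ideal /\ dcc right_ideal.

End Artinian.

(* The defining relations of the partial group algebra, for a family [f] of
   elements of an algebra. *)
Definition par_relations (K : fieldType) (G : groupType) (A : algType K)
    (f : G -> A) : Prop :=
  [/\ f 1%g = 1,
      forall s t, f s^-1%g * f s * f t = f s^-1%g * f (s * t)%g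
    & forall s t, f s * f t * f t^-1%g = f (s * t)%g * f t^-1%g].

Section PartialGroupAlgebra.
Variables (K : fieldType) (G : groupType).

(* Formal algebra expressions in the symbols [g]; [PScal c] stands for c1, so
   that scaling by c is multiplication by [PScal c]. *)
Inductive pterm : Type :=
| PGen of G
| PScal of K
| PAdd of pterm & pterm
| PMul of pterm & pterm.

HB.instance Definition _ := gen_eqMixin pterm.
HB.instance Definition _ := gen_choiceMixin pterm.

(* The least congruence on expressions containing the axioms of unital
   associative K-algebras and the relations of the partial group algebra. *)
Inductive pcong : pterm -> pterm -> Prop :=
| pcong_refl x : pcong x x
| pcong_sym x y : pcong x y -> pcong y x
| pcong_trans x y z : pcong x y -> pcong y z -> pcong x z
| pcong_add x x' y y' : pcong x x' -> pcong y y' ->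
    pcong (PAdd x y) (PAdd x' y')
| pcong_mul x x' y y' : pcong x x' -> pcong y y' ->
    pcong (PMul x y) (PMul x' y')
| pcong_addA x y z : pcong (PAdd x (PAdd y z)) (PAdd (PAdd x y) z)
| pcong_addC x y : pcong (PAdd x y) (PAdd y x)
| pcong_add0 x : pcong (PAdd (PScal 0) x) x
| pcong_mulA x y z : pcong (PMul x (PMul y z)) (PMul (PMul x y) z)
| pcong_mul1l x : pcong (PMul (PScal 1) x) x
| pcong_mulDl x y z : pcong (PMul (PAdd x y) z) (PAdd (PMul x z) (PMul y z))
| pcong_mulDr x y z : pcong (PMul x (PAdd y z)) (PAdd (PMul x y) (PMul x z))
| pcong_mul0 x : pcong (PMul (PScal 0) x) (PScal 0)
| pcong_scalD a b : pcong (PScal (a + b)) (PAdd (PScal a) (PScal b))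
| pcong_scalM a b : pcong (PScal (a * b)) (PMul (PScal a) (PScal b))
| pcong_scalC a x : pcong (PMul (PScal a) x) (PMul x (PScal a))
| pcong_gen1 : pcong (PGen 1%g) (PScal 1)
| pcong_genl s t : pcong (PMul (PMul (PGen s^-1%g) (PGen s)) (PGen t))
                         (PMul (PGen s^-1%g) (PGen (s * t)%g))
| pcong_genr s t : pcong (PMul (PMul (PGen s) (PGen t)) (PGen t^-1%g))
                         (PMul (PGen (s * t)%g) (PGen t^-1%g)).

Definition pcongb : rel pterm := fun x y => `[< pcong x y >].

Lemma pcongb_refl : reflexive pcongb.
Proof. by move=> x; apply/asboolP; apply: pcong_refl. Qed.

Lemma pcongb_sym : symmetric pcongb.
Proof.
by move=> x y; apply/asboolP/asboolP; apply: pcong_sym.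
Qed.

Lemma pcongb_trans : transitive pcongb.
Proof.
move=> y x z /asboolP xy /asboolP yz.
by apply/asboolP; apply: pcong_trans xy yz.
Qed.

Canonical pcong_equiv : equiv_rel pterm :=
  EquivRel pcongb pcongb_refl pcongb_sym pcongb_trans.

Local Open Scope quotient_scope.

Definition Kpar : Type := {eq_quot pcong_equiv}.

HB.instance Definition _ := Choice.on Kpar.

Definition pclass (x : pterm) : Kpar := \pi_{eq_quot pcong_equiv} x.

Lemma pclassP x y : pclass x = pclass y <-> pcong x y.
Proof.
split=> [/eqquotP/asboolP //|xy].
by apply/eqquotP/asboolP.
Qed.

Definition prep (u : Kpar) : pterm := repr (u : {eq_quot pcong_equiv}).

Lemma prepK : cancel prep pclass.
Proof. by move=> u; apply: reprK. Qed.

Lemma pclass_prep x : pcong (prep (pclass x)) x.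
Proof. by apply/pclassP; rewrite prepK. Qed.

Lemma pclass_ind (P : Kpar -> Prop) :
  (forall x, P (pclass x)) -> forall u, P u.
Proof. by move=> H u; rewrite -[u]prepK. Qed.

Definition par_add (u v : Kpar) : Kpar := pclass (PAdd (prep u) (prep v)).
Definition par_mul (u v : Kpar) : Kpar := pclass (PMul (prep u) (prep v)).
Definition par_scale (c : K) (u : Kpar) : Kpar :=
  pclass (PMul (PScal c) (prep u)).
Definition par_opp (u : Kpar) : Kpar := par_scale (-1) u.

Lemma par_addE x y : par_add (pclass x) (pclass y) = pclass (PAdd x y).
Proof. by apply/pclassP/pcong_add; apply: pclass_prep. Qed.

Lemma par_mulE x y : par_mul (pclass x) (pclass y) = pclass (PMul x y).
Proof. by apply/pclassP/pcong_mul; apply: pclass_prep. Qed.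

Lemma par_scaleE c x : par_scale c (pclass x) = pclass (PMul (PScal c) x).
Proof. by apply/pclassP/pcong_mul; [apply: pcong_refl|apply: pclass_prep]. Qed.

Fact par_addA : associative par_add.
Proof.
elim/pclass_ind=> x; elim/pclass_ind=> y; elim/pclass_ind=> z.
by rewrite !par_addE; apply/pclassP/pcong_addA.
Qed.

Fact par_addC : commutative par_add.
Proof.
elim/pclass_ind=> x; elim/pclass_ind=> y.
by rewrite !par_addE; apply/pclassP/pcong_addC.
Qed.

Fact par_add0 : left_id (pclass (PScal 0)) par_add.
Proof. by elim/pclass_ind=> x; rewrite par_addE; apply/pclassP/pcong_add0. Qed.

Fact par_addN : left_inverse (pclass (PScal 0)) par_opp par_add.
Proof.
elim/pclass_ind=> x; rewrite /par_opp par_scaleE par_addE; apply/pclassP.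
apply: pcong_trans (pcong_mul0 x); rewrite -[in X in pcong _ X](addNr 1).
apply: pcong_trans (pcong_mul (pcong_sym (pcong_scalD _ _)) (pcong_refl _)).
apply: pcong_trans (pcong_sym (pcong_mulDl _ _ _)).
by apply: pcong_add; [apply: pcong_refl|apply/pcong_sym/pcong_mul1l].
Qed.

HB.instance Definition _ :=
  GRing.isZmodule.Build Kpar par_addA par_addC par_add0 par_addN.

Fact par_mulA : associative par_mul.
Proof.
elim/pclass_ind=> x; elim/pclass_ind=> y; elim/pclass_ind=> z.
by rewrite !par_mulE; apply/pclassP/pcong_mulA.
Qed.

Fact par_mul1l : left_id (pclass (PScal 1)) par_mul.
Proof. by elim/pclass_ind=> x; rewrite par_mulE; apply/pclassP/pcong_mul1l. Qed.

Fact par_mul1r : right_id (pclass (PScal 1)) par_mul.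
Proof.
elim/pclass_ind=> x; rewrite par_mulE; apply/pclassP.
exact: pcong_trans (pcong_sym (pcong_scalC _ _)) (pcong_mul1l _).
Qed.

Fact par_mulDl : left_distributive par_mul par_add.
Proof.
elim/pclass_ind=> x; elim/pclass_ind=> y; elim/pclass_ind=> z.
by rewrite par_addE !par_mulE par_addE; apply/pclassP/pcong_mulDl.
Qed.

Fact par_mulDr : right_distributive par_mul par_add.
Proof.
elim/pclass_ind=> x; elim/pclass_ind=> y; elim/pclass_ind=> z.
by rewrite par_addE !par_mulE par_addE; apply/pclassP/pcong_mulDr.
Qed.

Section Evaluation.
Variables (A : algType K) (f : G -> A).

Fixpoint peval (x : pterm) : A :=
  match x with
  | PGen g => f g
  | PScal c => c%:A
  | PAdd x y => peval x + peval y
  | PMul x y => peval x * peval y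
  end.

Lemma peval_pcong : par_relations f ->
  forall x y, pcong x y -> peval x = peval y.
Proof.
case=> f1 fl fr x y; elim=> //=.
- by move=> *; congruence.
- by move=> ? ? ? ? _ -> _ ->.
- by move=> ? ? ? ? _ -> _ ->.
- by move=> *; rewrite addrA.
- by move=> *; rewrite addrC.
- by move=> *; rewrite scale0r add0r.
- by move=> *; rewrite mulrA.
- by move=> *; rewrite scale1r mul1r.
- by move=> *; rewrite mulrDl.
- by move=> *; rewrite mulrDr.
- by move=> *; rewrite scale0r mul0r.
- by move=> *; rewrite scalerDl.
- by move=> *; rewrite -scalerAl mul1r scalerA.
- by move=> *; rewrite -scalerAl mul1r -scalerAr mulr1.
- by rewrite f1 scale1r.
Qed.

Definition par_lift (u : Kpar) : A := peval (prep u).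

Lemma par_liftE : par_relations f -> forall x, par_lift (pclass x) = peval x.
Proof. by move=> fP x; apply: (peval_pcong fP); apply: pclass_prep. Qed.

End Evaluation.

Fact par_1_neq0 : pclass (PScal 1) != 0.
Proof.
apply/eqP => /pclassP h.
have fP : par_relations (fun _ : G => 1 : K^o) by split=> *; rewrite ?mulr1.
have := peval_pcong fP h; rewrite /= scale1r scale0r.
by move/eqP; rewrite oner_eq0.
Qed.

HB.instance Definition _ :=
  GRing.Zmodule_isNzRing.Build Kpar
    par_mulA par_mul1l par_mul1r par_mulDl par_mulDr par_1_neq0.

Lemma pclassD x y : pclass (PAdd x y) = pclass x + pclass y.
Proof. by rewrite -par_addE. Qed.

Lemma pclassM x y : pclass (PMul x y) = pclass x * pclass y.
Proof. by rewrite -par_mulE. Qed.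

Lemma par_scale_mul c u : par_scale c u = pclass (PScal c) * u.
Proof. by elim/pclass_ind: u => x; rewrite par_scaleE pclassM. Qed.

Lemma pclass_scalM a b :
  pclass (PScal (a * b)) = pclass (PScal a) * pclass (PScal b).
Proof. by rewrite -pclassM; apply/pclassP/pcong_scalM. Qed.

Lemma pclass_scalD a b :
  pclass (PScal (a + b)) = pclass (PScal a) + pclass (PScal b).
Proof. by rewrite -pclassD; apply/pclassP/pcong_scalD. Qed.

Lemma pclass_scalC a u : pclass (PScal a) * u = u * pclass (PScal a).
Proof.
by elim/pclass_ind: u => x; rewrite -!pclassM; apply/pclassP/pcong_scalC.
Qed.

Fact par_scaleA a b u : par_scale a (par_scale b u) = par_scale (a * b) u.
Proof. by rewrite !par_scale_mul pclass_scalM mulrA. Qed.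

Fact par_scale1 : left_id 1 par_scale.
Proof. by move=> u; rewrite par_scale_mul mul1r. Qed.

Fact par_scaleDr : right_distributive par_scale +%R.
Proof. by move=> a u v; rewrite !par_scale_mul mulrDr. Qed.

Fact par_scaleDl u : {morph par_scale^~ u : a b / a + b}.
Proof. by move=> a b; rewrite !par_scale_mul pclass_scalD mulrDl. Qed.

HB.instance Definition _ :=
  GRing.Zmodule_isLmodule.Build K Kpar
    par_scaleA par_scale1 par_scaleDr par_scaleDl.

Fact par_scaleAl (a : K) (u v : Kpar) : a *: (u * v) = (a *: u) * v.
Proof. by rewrite -![_ *: _]/(par_scale _ _) !par_scale_mul mulrA. Qed.

HB.instance Definition _ := GRing.Lmodule_isLalgebra.Build K Kpar par_scaleAl.

Fact par_scaleAr (a : K) (u v : Kpar) : a *: (u * v) = u * (a *: v).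
Proof.
by rewrite -![_ *: _]/(par_scale _ _) !par_scale_mul mulrA pclass_scalC mulrA.
Qed.

HB.instance Definition _ := GRing.Lalgebra_isAlgebra.Build K Kpar par_scaleAr.

Definition par_gen (g : G) : Kpar := pclass (PGen g).

Lemma par_gen_relations : par_relations par_gen.
Proof.
split=> [|s t|s t]; first exact/pclassP/pcong_gen1.
- rewrite /par_gen -(pclassM (PGen _) (PGen s)) -(pclassM (PMul _ _)).
  by rewrite -(pclassM (PGen _) (PGen (s * t)%g)); apply/pclassP/pcong_genl.
- rewrite /par_gen -(pclassM (PGen _) (PGen t)) -(pclassM (PMul _ _)).
  by rewrite -(pclassM (PGen (s * t)%g) (PGen _)); apply/pclassP/pcong_genr.
Qed.

Theorem Kpar_universal (A : algType K) (f : G -> A) : par_relations f ->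
  exists h : {lrmorphism Kpar -> A},
    (forall g, h (par_gen g) = f g) /\
    forall h' : {lrmorphism Kpar -> A},
      (forall g, h' (par_gen g) = f g) -> h' =1 h.
Proof.
move=> fP; have liftE := par_liftE fP.
have liftD : zmod_morphism (par_lift f).
  elim/pclass_ind=> x; elim/pclass_ind=> y.
  rewrite -[- _]/(par_opp _) /par_opp par_scaleE -pclassD !liftE /=.
  by rewrite -scalerAl mul1r scaleN1r.
have liftM : monoid_morphism (par_lift f).
  split; first by rewrite -[1]/(pclass (PScal 1)) liftE /= scale1r.
  elim/pclass_ind=> x; elim/pclass_ind=> y.
  by rewrite -pclassM !liftE.
have liftZ : scalable (par_lift f).
  move=> c; elim/pclass_ind=> x.
  by rewrite -[c *: _]/(par_scale _ _) par_scaleE !liftE /= -scalerAl mul1r.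
pose hD := GRing.isZmodMorphism.Build Kpar A (par_lift f) liftD.
pose hM := GRing.isMonoidMorphism.Build Kpar A (par_lift f) liftM.
pose hZ := GRing.isScalable.Build K Kpar A *:%R (par_lift f) liftZ.
pose h : {lrmorphism Kpar -> A} := HB.pack (par_lift f) hD hM hZ.
exists h; split=> [g|h' h'P]; first by rewrite /= /par_gen liftE.
elim/pclass_ind=> x; rewrite /= liftE; elim: x => [g|c|x ihx y ihy|x ihx y ihy].
- by rewrite /= -h'P.
- have -> : pclass (PScal c) = c *: 1.
    by rewrite -[c *: _]/(par_scale _ _) par_scale_mul mulr1.
  by rewrite linearZ /= rmorph1.
- by rewrite pclassD rmorphD /= ihx ihy.
- by rewrite pclassM rmorphM /= ihx ihy.
Qed.

End PartialGroupAlgebra.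

Arguments Kpar : clear implicits.
Arguments artinian : clear implicits.

(* Main.v *)
Require Import Defs.
From mathcomp Require Import all_boot all_order all_algebra.
From mathcomp Require Import classical_sets cardinality.
From HB Require Import structures.
From mathcomp Require Import boolp.

Set Implicit Arguments.
Unset Strict Implicit.
Unset Printing Implicit Defensive.

Local Open Scope classical_set_scope.

(** Write e_g = [g][g^-1]; these are commuting idempotents with
    [g] e_h = e_(gh) [g] and [s][t] = e_s [st].  Hence the elements
    e_(h_1) ... e_(h_k) [g] with distinct h_i span, so for finite G the algebra
    is finite-dimensional.  If G is infinite, take distinct g_0 = 1, g_1, ...;
    the left ideals generated by e_(g_n) ... e_(g_0) strictly decrease.  Indeed
    G acts partially by left translation on X = {g_0^-1, ..., g_n^-1}, and in
    the associated matrix representation e_g is the projection onto gX inter X,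
    so it fixes the basis vector of 1 if g is one of g_0, ..., g_n and kills it
    if g = g_(n+1). *)

Import GRing.Theory.

(** * Chain conditions in algebras with a finite spanning family *)

Section FiniteDimension.
Local Open Scope ring_scope.

(** Take [U] of maximal dimension among the subspaces contained in [S]: adjoining a vector of [S]
    keeps it inside [S], so the dimension cannot grow and the vector is already in [U]. *)
Lemma submod_vspace (K : fieldType) (V : vectType K) (S : set V) :
  S 0 -> (forall (c : K) u v, S u -> S v -> S (c *: u + v)) ->
  exists U : {vspace V}, forall v, v \in U <-> S v.
Proof.
move=> S0 SL.
pose P d := `[< exists U : {vspace V}, \dim U = d /\ (forall v, v \in U -> S v)>].
have P0 : P 0.
  by apply/asboolP; exists 0%VS; rewrite dimv0; split=> // v; rewrite memv0 => /eqP ->.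
have Pmax d : P d -> (d <= \dim {:V})%N.
  by move=> /asboolP[U [<- _]]; rewrite dimvS // subvf.
have [d /asboolP[U [dU US]] dmax] := ex_maxnP (ex_intro _ 0 P0) Pmax.
exists U => v; split=> [/US //|Sv].
have : P (\dim (U + <[v]>)%VS).
  apply/asboolP; exists (U + <[v]>)%VS; split=> // w /memv_addP[u /US Su].
  by move=> [_ /vlineP[c ->] ->]; rewrite addrC; apply: SL.
move/dmax; rewrite -dU => dimle.
have /eqP -> : U == (U + <[v]>)%VS by rewrite eqEdim addvSl.
by rewrite -{1}[v]add0r memv_add ?mem0v ?memv_line.
Qed.

(** The chain is pulled back along the surjection [phi] from the coordinate space. It becomes a
    decreasing chain of subspaces, constant from the point where the dimension is least. *)
Lemma dcc_submod_spanned (K : fieldType) (R : algType K) (I : finType)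
    (b : I -> R) (P : set (set R)) :
  (forall x, exists c : I -> K, x = \sum_i c i *: b i) ->
  (forall S, P S -> S 0 /\ forall (c : K) x y, S x -> S y -> S (c *: x + y)) ->
  dcc P.
Proof.
move=> span PL J PJ Jdec.
pose phi (v : {ffun I -> K^o}) : R := \sum_i (v i : K) *: b i.
have phi0 : phi 0 = 0 by rewrite /phi big1 // => i _; rewrite ffunE scale0r.
have phiL c u v : phi (c *: u + v) = c *: phi u + phi v.
  rewrite /phi scaler_sumr -big_split; apply: eq_bigr => i _ /=.
  by rewrite !ffunE scalerDl scalerA.
have phi_surj x : exists v, phi v = x.
  have [c ->] := span x; exists [ffun i => c i].
  by apply: eq_bigr => i _; rewrite ffunE.
have /choice[U UP] n : exists U : {vspace {ffun I -> K^o}},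
    forall v, v \in U <-> J n (phi v).
  have [J0 JL] := PL _ (PJ n).
  apply: (@submod_vspace K _ (fun v => J n (phi v))) => [|c u v Ju Jv].
    by rewrite phi0.
  by rewrite phiL; apply: JL.
have Jmono m n : (m <= n)%N -> J n `<=` J m.
  move=> /subnK <-; elim: (n - m)%N => [|k IHk] //.
  by rewrite addSn; apply: subset_trans IHk.
pose Q d := `[< exists n, \dim (U n) = d >].
have exQ : exists d, Q d by exists (\dim (U 0)); apply/asboolP; exists 0.
have [_ /asboolP[N <-] dmin] := ex_minnP exQ.
exists N => n leNn.
have UnN : (U n <= U N)%VS by apply/subvP => v /UP Jv; apply/UP/(Jmono N n).
have dimle : (\dim (U N) <= \dim (U n))%N by apply: dmin; apply/asboolP; exists n.
have /eqP eqU : U n == U N by rewrite eqEdim UnN.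
by apply/seteqP; split=> x; have [v <-] := phi_surj x; move=> /UP Uv; apply/UP;
  [rewrite -eqU|rewrite eqU].
Qed.

Lemma artinian_spanned (K : fieldType) (R : algType K) (I : finType)
    (b : I -> R) :
  (forall x, exists c : I -> K, x = \sum_i c i *: b i) -> artinian R.
Proof.
move=> span.
have BD (S : set R) : S 0 -> (forall x y, S x -> S y -> S (x - y)) ->
    forall x y, S x -> S y -> S (x + y).
  move=> S0 SB x y Sx Sy; rewrite -[y]opprK -[- y]sub0r.
  exact: (SB _ _ Sx (SB _ _ S0 Sy)).
(* One-sided ideals are subspaces, since [c *: x] is both [c%:A * x] and [x * c%:A]. *)
split; apply: (dcc_submod_spanned span) => S [S0 SB SM].
- by split=> // c x y Sx Sy; rewrite -mulr_algl; apply: BD Sy => //; apply: SM.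
- by split=> // c x y Sx Sy; rewrite -mulr_algr; apply: BD Sy => //; apply: SM.
Qed.

End FiniteDimension.

(** * The idempotents e_g and a finite spanning family *)

Section Idempotents.
Local Open Scope ring_scope.
Variables (K : fieldType) (G : groupType).
Local Notation gen := (@par_gen K G).

Definition par_idem (g : G) : Kpar K G := gen g * gen g^-1%g.

Lemma par_gen1 : gen 1%g = 1.
Proof. by have [] := par_gen_relations K G. Qed.

Lemma par_genM s t : gen s * gen t = par_idem s * gen (s * t)%g.
Proof.
have [g1 gl gr] := par_gen_relations K G.
have genK : gen s * gen s^-1%g * gen s = gen s.
  by have := gr s s^-1%g; rewrite invgK mulgV g1 mul1r.
rewrite -[in LHS]genK /par_idem -!mulrA; congr (_ * _).
by rewrite mulrA gl.
Qed.

(** Both sides reduce to [gen (s * t) * gen t^-1], the left one by the right-hand relation and the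
    right one by the left-hand relation. *)
Lemma par_gen_idem s t : gen s * par_idem t = par_idem (s * t)%g * gen s.
Proof.
have [g1 gl gr] := par_gen_relations K G.
rewrite /par_idem mulrA gr.
have := gl (s * t)^-1%g s; rewrite invgK => ->.
by rewrite invgM -mulgA mulVg mulg1.
Qed.

(** Moving e_t leftwards past [s^-1] and then past [s] translates its index by s^-1 and then by s,
    which restores t. *)
Lemma par_idemC s t : par_idem s * par_idem t = par_idem t * par_idem s.
Proof.
rewrite {1}/par_idem -mulrA par_gen_idem mulrA par_gen_idem.
by rewrite mulgA mulgV mul1g -mulrA.
Qed.

Lemma par_idemK s : par_idem s * par_idem s = par_idem s.
Proof.
have [g1 gl gr] := par_gen_relations K G.
by rewrite /par_idem -mulrA (mulrA (gen s^-1%g)) gr mulVg g1 mul1r.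
Qed.

Definition par_idems (l : seq G) : Kpar K G := \prod_(h <- l) par_idem h.

Lemma par_gen_idems s l :
  gen s * par_idems l = par_idems [seq (s * h)%g | h <- l] * gen s.
Proof.
rewrite /par_idems; elim: l => [|h l IHl] /=; first by rewrite !big_nil mulr1 mul1r.
by rewrite !big_cons mulrA par_gen_idem -mulrA IHl mulrA.
Qed.

Lemma par_idem_absorb h l : h \in l -> par_idem h * par_idems l = par_idems l.
Proof.
rewrite /par_idems; elim: l => [//|k l IHl]; rewrite inE big_cons mulrA.
have [<- _|_ /= hl] := eqVneq h k; first by rewrite par_idemK.
by rewrite par_idemC -mulrA IHl.
Qed.

Lemma par_idems_undup l : par_idems (undup l) = par_idems l.
Proof.
elim: l => [//|h l IHl] /=; rewrite [in RHS]/par_idems big_cons -/(par_idems l).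
case: ifP => hl; first by rewrite IHl par_idem_absorb.
by rewrite /par_idems big_cons -/(par_idems _) IHl.
Qed.

Lemma par_gen_idems_gen s l t : gen s * (par_idems l * gen t) =
  par_idems (rcons [seq (s * h)%g | h <- l] s) * gen (s * t)%g.
Proof.
rewrite mulrA par_gen_idems -mulrA par_genM mulrA.
by rewrite /par_idems -cats1 big_cat big_seq1.
Qed.

Lemma Kpar_ind (P : Kpar K G -> Prop) :
  (forall g, P (gen g)) -> (forall c : K, P c%:A) ->
  (forall u v, P u -> P v -> P (u + v)) ->
  (forall u v, P u -> P v -> P (u * v)) -> forall u, P u.
Proof.
move=> Pg Ps PD PM u; rewrite -[u]prepK; elim: (prep u) => [g|c|x Px y Py|x Px y Py].
- exact: Pg.
- have -> : pclass (PScal _ c) = c%:A :> Kpar K G; last exact: Ps.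
  by rewrite -[c%:A]/(par_scale _ _) par_scale_mul mulr1.
- by rewrite pclassD; apply: PD.
- by rewrite pclassM; apply: PM.
Qed.

Lemma Kpar_spanned : finite_set [set: G] ->
  exists (I : finType) (b : I -> Kpar K G),
    forall u, exists c : I -> K, u = \sum_i c i *: b i.
Proof.
move=> /finite_seqP[s sE].
have sin h : h \in s by have : [set: G] h by []; rewrite sE.
have sFin : Finite.axiom (undup s : seq G).
  by move=> g; rewrite count_uniq_mem ?undup_uniq // mem_undup sin.
have sK : cancel (index^~ s) (nth 1%g s).
  by move=> g; rewrite nth_index.
pose gT : finType :=
  HB.pack (Choice.sort G) (CanIsCountable sK) (isFinite.Build G sFin).
pose I : finType := ({bseq size s of gT} * gT)%type.
pose b (i : I) : Kpar K G := par_idems (i.1 : seq gT) * gen i.2.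
exists I, b.
pose S (u : Kpar K G) := exists c : I -> K, u = \sum_i c i *: b i.
have S0 : S 0 by exists (fun=> 0); rewrite big1 // => i _; rewrite scale0r.
have SD u v : S u -> S v -> S (u + v).
  move=> [c ->] [d ->]; exists (fun i => c i + d i).
  by rewrite -big_split; apply: eq_bigr => i _; rewrite scalerDl.
have SZ a u : S u -> S (a *: u).
  move=> [c ->]; exists (fun i => a * c i).
  by rewrite scaler_sumr; apply: eq_bigr => i _; rewrite scalerA.
have Sb l t : S (par_idems l * gen t).
  have lP : (size (undup l : seq gT) <= size s)%N.
    by apply: uniq_leq_size (undup_uniq l) _ => g _; apply: sin.
  pose j : I := (Bseq lP, t); exists (fun i => (i == j)%:R).
  rewrite (bigD1 j) //= eqxx scale1r big1 ?addr0.
    by rewrite /b /= par_idems_undup.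
  by move=> i /negPf ->; rewrite scale0r.
(* The span [S] contains 1, as the empty product of idempotents times [gen 1], so stability under
   left multiplication makes it everything. *)
suff SM u : forall v, S v -> S (u * v).
  move=> u; rewrite -[u]mulr1; apply: SM.
  by rewrite -[1]mulr1 -{2}par_gen1 -[1](big_nil 1 *%R xpredT par_idem); apply: Sb.
elim/Kpar_ind: u => [g|c|u v Su Sv|u v Su Sv] w Sw.
- have [c ->] := Sw; rewrite mulr_sumr; apply: (big_ind S) => // i _.
  by rewrite -scalerAr par_gen_idems_gen; apply: SZ.
- by rewrite mulr_algl; apply: SZ.
- by rewrite mulrDl; apply: SD; [apply: Su|apply: Sv].
- by rewrite -mulrA; apply/Su/Sv.
Qed.

End Idempotents.

(** * Matrices of the partial left translation action on a finite subset *)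

Section TranslationMatrices.
Local Open Scope ring_scope.
Variables (K : fieldType) (G : groupType) (n : nat) (x : 'I_n.+1 -> G).
Hypothesis x_inj : injective x.

Definition trans_mx (g : G) : 'M[K]_n.+1 :=
  \matrix_(i, j) (x i == (g * x j)%g)%:R.

Definition trans_proj (g : G) : 'M[K]_n.+1 :=
  diag_mx (\row_i [exists k, x i == (g * x k)%g]%:R).

Lemma trans_mx1 : trans_mx 1%g = 1.
Proof.
by apply/matrixP => i j; rewrite !mxE mul1g (inj_eq x_inj).
Qed.

(** As [x] is injective, at most one intermediate index k satisfies x_i = s x_k, so the sum has at
    most one nonzero term. *)
Lemma trans_mxE s t i j :
  (trans_mx s * trans_mx t) i j =
    ([exists k, x i == (s * x k)%g] && (x i == (s * t * x j)%g))%:R.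
Proof.
rewrite !mxE.
have [/existsP[k /eqP xik]|/existsPn nex] :=
    boolP [exists k, x i == (s * x k)%g].
  rewrite (bigD1 k) //= big1 => [|k' k'k]; rewrite !mxE ?addr0.
    by rewrite xik eqxx mul1r -mulgA (inj_eq (mulgI s)).
  by rewrite xik (inj_eq (mulgI s)) (inj_eq x_inj) eq_sym (negPf k'k) mul0r.
by rewrite big1 // => k _; rewrite !mxE (negPf (nex k)) mul0r.
Qed.

Lemma trans_mxMl s t : trans_mx s * trans_mx t = trans_proj s * trans_mx (s * t)%g.
Proof.
apply/matrixP => i j; rewrite trans_mxE -[(_ * trans_mx (s * t)%g)]/(_ *m _).
by rewrite mul_diag_mx !mxE; case: [exists _, _]; rewrite ?mul1r ?mul0r.
Qed.

(** Once x_i = s t x_j, the condition x_i = s x_k on the target is the condition x_j = t^-1 x_k on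
    the source. *)
Lemma trans_mxMr s t :
  trans_mx s * trans_mx t = trans_mx (s * t)%g * trans_proj t^-1%g.
Proof.
apply/matrixP => i j; rewrite trans_mxE -[(_ * trans_proj _)]/(_ *m _).
rewrite mul_mx_diag !mxE.
have [xij|_] := eqVneq (x i) _; rewrite ?andbF ?mul0r // andbT mul1r.
congr (nat_of_bool _)%:R; apply: eq_existsb => k.
by rewrite xij -mulgA (inj_eq (mulgI s)) -[RHS](inj_eq (mulgI t)) mulVKg.
Qed.

Lemma trans_mx_relations : par_relations trans_mx.
Proof.
split=> [|s t|s t]; first exact: trans_mx1.
(* Here [trans_mx s^-1 * trans_mx s] is [trans_proj s^-1], and the same projection splits off on the
   right-hand side. *)
- by rewrite [in LHS]trans_mxMl mulVg trans_mx1 mulr1 [RHS]trans_mxMl mulKg.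
- rewrite -mulrA [X in _ * X]trans_mxMr mulgV trans_mx1 mul1r.
  by rewrite [RHS]trans_mxMr mulgK.
Qed.

Lemma trans_projE g i : trans_proj g *m delta_mx i ord0 =
  [exists k, x i == (g * x k)%g]%:R *: delta_mx i ord0 :> 'cV[K]_n.+1.
Proof.
apply/matrixP => j k; rewrite mul_diag_mx !mxE ord1 eqxx andbT.
by have [->|_] := eqVneq j i; rewrite ?mulr0.
Qed.

End TranslationMatrices.

(** * A strictly decreasing chain of left ideals for infinite G *)

Section Infinite.
Local Open Scope ring_scope.
Variables (K : fieldType) (G : groupType) (g : nat -> G).
Hypotheses (g_inj : injective g) (g0 : g 0 = 1%g).

Fixpoint idem_chain (n : nat) : Kpar K G :=
  if n is m.+1 then par_idem K (g m.+1) * idem_chain m else par_idem K (g 0).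

Lemma idem_chain_strict n a : idem_chain n <> a * idem_chain n.+1.
Proof.
pose x (i : 'I_n.+1) := (g i)^-1%g.
have x_inj : injective x by move=> i j /invg_inj/g_inj/val_inj.
have [h [hgen _]] := Kpar_universal (trans_mx_relations K x_inj).
have h_idem k : h (par_idem K (g k)) *m delta_mx ord0 ord0 =
    ((k <= n)%N : nat)%:R *: delta_mx ord0 ord0 :> 'cV[K]_n.+1.
  rewrite rmorphM /= !hgen [X in X *m _]trans_mxMl //.
  rewrite mulgV trans_mx1 // mulr1 trans_projE; congr ((nat_of_bool _)%:R *: _).
  (* The basis vector at index 0 stands for the point 1; and 1 = g_k g_j^-1 with j at most n forces
     j = k. *)
  rewrite /x g0 invg1; apply/existsP/idP => [[j]|kn].
    move=> /eqP/(congr1 (fun y => y * g j)%g); rewrite mul1g mulgVK => /g_inj <-.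
    by rewrite -ltnS.
  by exists (Ordinal (kn : (k < n.+1)%N)); rewrite mulgV.
have h_chain m : (m <= n)%N ->
    h (idem_chain m) *m delta_mx ord0 ord0 = delta_mx ord0 ord0 :> 'cV[K]_n.+1.
  elim: m => [|m IHm] mn; first by rewrite h_idem scale1r.
  by rewrite rmorphM -mulmxA IHm ?(ltnW mn) // h_idem mn scale1r.
(* On this vector [idem_chain n] acts as the identity, after which the factor e_(g_(n+1)) gives 0
   whatever [a] is. *)
move=> /(congr1 (fun u => h u *m (delta_mx ord0 ord0 : 'cV[K]_n.+1))).
rewrite /= 2!rmorphM /= -!mulmxA !h_chain // h_idem ltnn scale0r mulmx0.
by move/matrixP/(_ ord0 ord0)/eqP; rewrite !mxE oner_eq0.
Qed.

Lemma Kpar_not_artinian : ~ artinian (Kpar K G).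
Proof.
move=> [dccl _].
pose I n : set (Kpar K G) := [set u | exists a, u = a * idem_chain n].
have I_ideal n : left_ideal (I n).
  split=> [|_ _ [a ->] [b ->]|a _ [b ->]]; first by exists 0; rewrite mul0r.
  - by exists (a - b); rewrite mulrBl.
  - by exists (a * b); rewrite mulrA.
have [|N IN] := dccl I I_ideal.
  by move=> n _ [a ->]; exists (a * par_idem K (g n.+1)); rewrite -mulrA.
have : I N (idem_chain N) by exists 1; rewrite mul1r.
by rewrite -(IN N.+1) // => -[a]; apply: idem_chain_strict.
Qed.

End Infinite.

Theorem corollary4p3 (K : fieldType) (G : groupType) :
  artinian (Kpar K G) <-> finite_set [set: G].
Proof.
split=> [art|/(Kpar_spanned K)[I [b span]]]; last exact: artinian_spanned span.
pose pG : pointedType := HB.pack (Choice.sort G) (isPointed.Build G 1%g).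
apply: contrapT => /infiniteP/(@pcard_leP nat pG)/injfunPex[f _ f_injT].
have f_inj : injective f by (move=> m n; apply: f_injT; rewrite inE).
(* Left translation by (f 0)^-1 makes the injective sequence start at 1. *)
apply: (@Kpar_not_artinian K G (fun n => (f 0)^-1 * f n)%g) art => [m n|].
  by move=> /mulgI/f_inj.
by rewrite mulVg.
Qed.
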